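(* Let $\mathbb{D}$ be any commutative ring with identity and let $\mathcal{R}=\mathcal{R}(\mathbb{D})$ be the Riordan group with coefficients in $\mathbb{D}$. If $n\geq 4$, there exists no monomorphism (injective group homomorphism) $\mu: S_n\to \mathcal{R}$, where $S_n$ is the symmetric group of degree $n$.
   Context: Let $\mathbb{D}$ be a commutative ring with identity (possibly with zero divisors), and let $\mathbb{D}^*$ be its group of units. The Riordan group $\mathcal{R}(\mathbb{D})$ consists of all pairs $(g(t),f(t))$ of formal power series in $\mathbb{D}[[t]]$ with $g(t)=\sum_{k\ge 0} g_kt^k$, $g_0\in\mathbb{D}^*$, and $f(t)=\sum_{k\ge 1} f_kt^k$, $f_1\in\mathbb{D}^*$. The group operation is $$(g_1(t),f_1(t))\,(g_2(t),f_2(t))=\bigl(g_1(t)\,g_2(f_1(t)),\ f_2(f_1(t))\bigr)$$ (here $f_1(t),f_2(t)$ denote power series), and the identity is $(1,t)$. The pair $(g,f)$ is identified with the infinite lower triangular matrix (Riordan array) $(d_{n,k})_{n,k\ge 0}$, $d_{n,k}=[t^n]\,g(t)f(t)^k$, where $[t^n]h(t)$ is the coefficient of $t^n$ in $h(t)$; under this identification the operation is matrix multiplication. *)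

(* Defs.v *)
From HB Require Import structures.
From mathcomp Require Import all_boot all_order all_algebra all_fingroup.
From mathcomp Require Import boolp.

Set Implicit Arguments.
Unset Strict Implicit.
Unset Printing Implicit Defensive.

Import GRing.Theory.
Local Open Scope ring_scope.

(* GRing.unit is only available on unitRingType, which carries a chosen inverse
   and excludes the zero ring; over an arbitrary commutative ring we state
   invertibility propositionally. *)
Definition is_unit (D : comPzRingType) (x : D) : Prop :=
  exists y : D, x * y = 1.

(* Formal power series \sum_k f_k t^k, given by their coefficients k |-> f_k;
   `f n` is the coefficient [t^n] f. *)
Record fps (D : Type) := FPS { fps_coef :> nat -> D }.

Section PowerSeriesRing.
Variable D : comPzRingType.
Implicit Types f g h : fps D.

Lemma fpsP f g : (forall n, f n = g n) -> f = g.
Proof. by case: f g => [f] [g] /= fg; congr FPS; apply/funext. Qed.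

HB.instance Definition _ := gen_eqMixin (fps D).
HB.instance Definition _ := gen_choiceMixin (fps D).

Definition fps_zero : fps D := FPS (fun=> 0).
Definition fps_opp f : fps D := FPS (fun n => - f n).
Definition fps_add f g : fps D := FPS (fun n => f n + g n).
Definition fps_one : fps D := FPS (fun n => (n == 0)%:R).
Definition fps_mul f g : fps D :=
  FPS (fun n => \sum_(i < n.+1) f i * g (n - i)%N).

Fact fps_addA : associative fps_add.
Proof. by move=> f g h; apply: fpsP => n /=; rewrite addrA. Qed.
Fact fps_addC : commutative fps_add.
Proof. by move=> f g; apply: fpsP => n /=; rewrite addrC. Qed.
Fact fps_add0 : left_id fps_zero fps_add.
Proof. by move=> f; apply: fpsP => n /=; rewrite add0r. Qed.
Fact fps_addN : left_inverse fps_zero fps_opp fps_add.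
Proof. by move=> f; apply: fpsP => n /=; rewrite addNr. Qed.

HB.instance Definition _ :=
  GRing.isZmodule.Build (fps D) fps_addA fps_addC fps_add0 fps_addN.

Fact fps_mulC : commutative fps_mul.
Proof.
move=> f g; apply: fpsP => n /=; rewrite (reindex_inj rev_ord_inj) /=.
by apply: eq_bigr => i _; rewrite subSS subKn ?leq_ord // mulrC.
Qed.

Fact fps_mulA : associative fps_mul.
Proof.
move=> f g h; apply: fpsP => n; rewrite [in RHS]fps_mulC /=.
pose F j k := f j * (g (n - j - k)%N * h k).
transitivity (\sum_(j < n.+1) \sum_(k < n.+1 | (k <= n - j)%N) F j k).
  apply: eq_bigr => j _.
  transitivity (f j * fps_mul h g (n - j)%N); first by rewrite fps_mulC.
  rewrite /= mulr_sumr.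
  rewrite (big_ord_narrow_leq (leq_subr _ _)) /F.
  by apply: eq_bigr => k _ /=; rewrite (mulrC (h k)).
rewrite (exchange_big_dep predT) //=; apply: eq_bigr => k _.
transitivity (\sum_(j < n.+1 | (j <= n - k)%N) F j k).
  apply: eq_bigl => j; rewrite -ltnS -(ltnS j) -!subSn ?leq_ord //.
  by rewrite -subn_gt0 -(subn_gt0 j) -!subnDA addnC.
rewrite (big_ord_narrow_leq (leq_subr _ _)) mulr_sumr.
apply: eq_bigr => j _ /=; rewrite /F.
by rewrite [RHS]mulrC -mulrA -!subnDA addnC.
Qed.

Fact fps_mul1 : left_id fps_one fps_mul.
Proof.
move=> f; apply: fpsP => n /=.
by rewrite big_ord_recl /= big1 ?mul1r ?addr0 ?subn0 // => i _; rewrite mul0r.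
Qed.

Fact fps_mulDl : left_distributive fps_mul fps_add.
Proof.
move=> f g h; apply: fpsP => n /=; rewrite -big_split /=.
by apply: eq_bigr => i _; rewrite mulrDl.
Qed.

HB.instance Definition _ := GRing.Zmodule_isComPzRing.Build (fps D)
  fps_mulA fps_mulC fps_mul1 fps_mulDl.

End PowerSeriesRing.

Section Composition.
Variable D : comPzRingType.
Implicit Types f g h : fps D.

Definition fpsX : fps D := FPS (fun n => (n == 1%N)%:R).

(* fps_comp h f is the substitution h(f(t)) = \sum_k h_k f^k, meant for series
   f with f_0 = 0: then [t^n] f^k = 0 for k > n, so that truncating the sum at
   k = n loses nothing. *)
Definition fps_comp h f : fps D :=
  FPS (fun n => \sum_(k < n.+1) h k * (f ^+ k) n).

Lemma coef_fpsM f g n : (f * g) n = \sum_(i < n.+1) f i * g (n - i)%N.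
Proof. by []. Qed.

Lemma coef_fps1 n : (1 : fps D) n = (n == 0)%:R.
Proof. by []. Qed.

Lemma coef0_fpsM f g : (f * g) 0%N = f 0%N * g 0%N.
Proof. by rewrite coef_fpsM big_ord1. Qed.

Lemma coef_fpsXn_gt f k n : f 0%N = 0 -> (n < k)%N -> (f ^+ k) n = 0.
Proof.
move=> f0; elim: k n => // k IHk n; rewrite ltnS => le_nk.
rewrite exprS coef_fpsM big_ord_recl f0 mul0r add0r big1 // => i _.
rewrite IHk ?mulr0 //= /bump /= add1n (leq_trans _ le_nk) // ltn_subrL.
by rewrite (leq_trans _ (ltn_ord i)).
Qed.

Lemma coef_fpsXn_diag f n : f 0%N = 0 -> (f ^+ n) n = f 1%N ^+ n.
Proof.
move=> f0; elim: n => // n IHn.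
rewrite exprS coef_fpsM big_ord_recl f0 mul0r add0r big_ord_recl /= subSS subn0.
rewrite IHn big1 ?addr0 ?exprS // => i _.
rewrite coef_fpsXn_gt ?mulr0 //= /bump /= !add1n subSS ltn_subrL.
by rewrite (leq_trans _ (ltn_ord i)).
Qed.

Lemma coef_fps_comp h f n m : f 0%N = 0 -> (n <= m)%N ->
  fps_comp h f n = \sum_(k < m.+1) h k * (f ^+ k) n.
Proof.
move=> f0 le_nm; rewrite /fps_comp /=.
rewrite (big_ord_widen _ (fun k => h k * (f ^+ k) n) (_ : n.+1 <= m.+1)%N) //.
rewrite [RHS](bigID (fun k : 'I_m.+1 => (k < n.+1)%N)) /=.
rewrite [X in _ = _ + X]big1 ?addr0 // => k; rewrite -leqNgt => lt_nk.
by rewrite coef_fpsXn_gt ?mulr0.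
Qed.

Lemma coef0_fps_comp h f : fps_comp h f 0%N = h 0%N.
Proof. by rewrite /fps_comp /= big_ord1 expr0 mulr1. Qed.

Lemma coef1_fps_comp h f : f 0%N = 0 -> fps_comp h f 1%N = h 1%N * f 1%N.
Proof.
move=> f0; rewrite /fps_comp /= !big_ord_recl big_ord0 expr0 mulr0 add0r.
by rewrite addr0.
Qed.

Lemma fps_compX h : fps_comp h fpsX = h.
Proof.
have Xn k n : (fpsX ^+ k) n = (n == k)%:R :> D.
  elim: k n => // k IHk [|n].
    by rewrite coef_fpsXn_gt.
  rewrite exprS coef_fpsM big_ord_recl mul0r add0r big_ord_recl /= mul1r.
  rewrite IHk subSS subn0 big1 ?addr0 // => i _.
  by rewrite mul0r.
apply: fpsP => n; rewrite /= big_ord_recr /= Xn eqxx mulr1.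
rewrite big1 ?add0r // => i _.
by rewrite Xn gtn_eqF ?mulr0.
Qed.

Lemma fps_Xcomp f : f 0%N = 0 -> fps_comp fpsX f = f.
Proof.
move=> f0; apply: fpsP => n.
rewrite (@coef_fps_comp _ _ _ n.+1) // !big_ord_recl /= mul0r add0r mul1r expr1.
by rewrite big1 ?addr0 // => i _; rewrite mul0r.
Qed.

Lemma fps_comp1 f : fps_comp 1 f = 1.
Proof.
apply: fpsP => n; rewrite /= big_ord_recl big1 ?addr0 => [|i _].
  by rewrite mul1r expr0.
by rewrite mul0r.
Qed.

Lemma fps_compM f g h : f 0%N = 0 ->
  fps_comp (g * h) f = fps_comp g f * fps_comp h f.
Proof.
move=> f0; apply: fpsP => n; rewrite coef_fpsM.
transitivity (\sum_(i < n.+1) \sum_(j < n.+1) g i * h j * (f ^+ (i + j)) n);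
  last first.
  under [RHS]eq_bigr => a _.
    rewrite (@coef_fps_comp _ _ a n) ?leq_ord //.
    rewrite (@coef_fps_comp _ _ (n - a) n) ?leq_subr // mulr_suml.
    under eq_bigr => i _ do rewrite mulr_sumr.
    over.
  rewrite [RHS]exchange_big /=; apply: eq_bigr => i _.
  rewrite [RHS]exchange_big /=; apply: eq_bigr => j _.
  rewrite exprD coef_fpsM mulr_sumr; apply: eq_bigr => a _.
  by rewrite mulrACA.
pose G i k := g i * h (k - i)%N * (f ^+ k) n.
transitivity (\sum_(k < n.+1) \sum_(i < n.+1 | (i <= k)%N) G i k).
  apply: eq_bigr => k _; rewrite coef_fpsM mulr_suml.
  by rewrite (big_ord_widen _ (G^~ k) (ltn_ord k)).
rewrite (exchange_big_dep predT) //=; apply: eq_bigr => i _.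
rewrite [LHS](_ : _ = \sum_(0 <= k < n.+1 | (i <= k)%N) G i k);
  last by rewrite big_mkord.
rewrite (big_cat_nat _ (n := i)) //=; last by rewrite ltnW.
rewrite big_nat_cond big1 ?add0r; last first.
  by move=> k /andP[/andP[_ lt_ki]]; rewrite leqNgt lt_ki.
rewrite -[X in \sum_(X <= _ < _ | _) _]add0n big_addn.
rewrite (eq_bigl predT) => [|k]; last by rewrite leq_addl.
rewrite big_mkord (big_ord_widen _ (fun k => G i (k + i)%N) (leq_subr i n.+1)).
rewrite [RHS](bigID (fun j : 'I_n.+1 => (j < n.+1 - i)%N)) /=.
rewrite [X in _ = _ + X]big1 ?addr0 => [|j].
  by apply: eq_bigr => j _; rewrite /G addnK addnC.
rewrite -leqNgt leq_subLR => lt_n.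
by rewrite coef_fpsXn_gt ?mulr0.
Qed.

Lemma fps_compXn f g k : f 0%N = 0 -> fps_comp (g ^+ k) f = fps_comp g f ^+ k.
Proof.
move=> f0; elim: k => [|k IHk]; first by rewrite fps_comp1.
by rewrite !exprS fps_compM // IHk.
Qed.

Lemma fps_compA f g h : f 0%N = 0 -> g 0%N = 0 ->
  fps_comp h (fps_comp g f) = fps_comp (fps_comp h g) f.
Proof.
move=> f0 g0; apply: fpsP => n.
transitivity (\sum_(k < n.+1) \sum_(j < n.+1) h k * ((g ^+ k) j * (f ^+ j) n)).
  by apply: eq_bigr => k _; rewrite -fps_compXn // -mulr_sumr.
rewrite exchange_big; apply: eq_bigr => j _.
rewrite (@coef_fps_comp h g j n) ?leq_ord // mulr_suml.
by apply: eq_bigr => k _; rewrite mulrA.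
Qed.

Lemma lower_triangular_solve (A : nat -> nat -> D) (b : nat -> D) :
  (forall n, is_unit (A n n)) ->
  exists x : fps D, forall n, \sum_(k < n.+1) x k * A n k = b n.
Proof.
move=> /choice[iv ivP].
pose next (s : seq D) := let m := size s in
  iv m * (b m - \sum_(k < m) nth 0 s k * A m k).
pose s n := iter n (fun s => rcons s (next s)) [::].
have sS n : s n.+1 = rcons (s n) (next (s n)) by [].
have size_s n : size (s n) = n
  by elim: n => // n IHn; rewrite sS size_rcons IHn.
have nth_s n k : (k < n)%N -> nth 0 (s n) k = nth 0 (s k.+1) k.
  elim: n => // n IHn; rewrite ltnS leq_eqVlt => /predU1P[->//|lt_kn].
  by rewrite sS nth_rcons size_s lt_kn IHn.
exists (FPS (fun n => nth 0 (s n.+1) n)) => n; rewrite big_ord_recr /=.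
rewrite nth_rcons size_s ltnn eqxx /next size_s.
rewrite mulrAC [iv n * _]mulrC ivP mul1r.
under [in X in X + _]eq_bigr => k _ do rewrite -sS -(@nth_s n) //.
by rewrite addrC subrK.
Qed.

End Composition.

Record riordan (D : comPzRingType) := Riordan {
  riordan_g : fps D;
  riordan_f : fps D;
  riordan_g0 : is_unit (riordan_g 0%N);
  riordan_f0 : riordan_f 0%N = 0;
  riordan_f1 : is_unit (riordan_f 1%N)
}.

Section RiordanGroup.
Variable D : comPzRingType.
Implicit Types r s : riordan D.

Lemma is_unit1 : is_unit (1 : D).
Proof. by exists 1; rewrite mulr1. Qed.

Lemma is_unitM (x y : D) : is_unit x -> is_unit y -> is_unit (x * y).
Proof.
by move=> [x' xx'] [y' yy']; exists (x' * y'); rewrite mulrACA xx' yy' mulr1.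
Qed.

Lemma is_unitX (x : D) n : is_unit x -> is_unit (x ^+ n).
Proof. by move=> [y xy]; exists (y ^+ n); rewrite -exprMn xy expr1n. Qed.

Lemma is_unitMr (x y : D) : is_unit (x * y) -> is_unit y.
Proof. by move=> [z xyz]; exists (x * z); rewrite mulrCA mulrA. Qed.

Lemma riordanP r s :
  riordan_g r = riordan_g s -> riordan_f r = riordan_f s -> r = s.
Proof.
case: r s => [g f g0 f0 f1] [g' f' g0' f0' f1'] /= eg ef; subst g' f'.
by congr Riordan; apply: Prop_irrelevance.
Qed.

HB.instance Definition _ := gen_eqMixin (riordan D).
HB.instance Definition _ := gen_choiceMixin (riordan D).

Fact riordan_one_subproof : is_unit (fpsX D 1%N).
Proof. exact: is_unit1. Qed.

Definition riordan_one : riordan D :=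
  @Riordan D 1 (fpsX D) is_unit1 (erefl _) riordan_one_subproof.

Fact riordan_mul_g0 r s :
  is_unit ((riordan_g r * fps_comp (riordan_g s) (riordan_f r)) 0%N).
Proof.
by rewrite coef0_fpsM coef0_fps_comp; apply: is_unitM; apply: riordan_g0.
Qed.

Fact riordan_mul_f0 r s : fps_comp (riordan_f s) (riordan_f r) 0%N = 0.
Proof. by rewrite coef0_fps_comp riordan_f0. Qed.

Fact riordan_mul_f1 r s : is_unit (fps_comp (riordan_f s) (riordan_f r) 1%N).
Proof.
rewrite coef1_fps_comp; last exact: riordan_f0.
by apply: is_unitM; apply: riordan_f1.
Qed.

(* (g1, f1) (g2, f2) = (g1 g2(f1), f2(f1)) *)
Definition riordan_mul r s : riordan D :=
  Riordan (riordan_mul_g0 r s) (riordan_mul_f0 r s) (riordan_mul_f1 r s).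

Fact riordan_mulA : associative riordan_mul.
Proof.
move=> r s u; apply: riordanP => /=; last first.
  by rewrite fps_compA //; apply: riordan_f0.
by rewrite fps_compM ?fps_compA ?mulrA //; apply: riordan_f0.
Qed.

Fact riordan_mul1r : left_id riordan_one riordan_mul.
Proof. by move=> r; apply: riordanP; rewrite /= fps_compX ?mul1r. Qed.

Fact riordan_mulr1 : right_id riordan_one riordan_mul.
Proof.
move=> r; apply: riordanP; rewrite /= ?fps_comp1 ?mulr1 //.
exact/fps_Xcomp/riordan_f0.
Qed.

Fact riordan_right_inverse r : exists s, riordan_mul r s = riordan_one.
Proof.
case: r => g f g0 f0 f1.
have [x xP] : exists x : fps D, g * fps_comp x f = 1.
  have [|x xP] := @lower_triangular_solve D
    (fun n k => (g * f ^+ k) n) (1 : fps D).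
    move=> n; rewrite coef_fpsM big_ord_recl subn0 big1 ?addr0 => [|i _].
      by rewrite coef_fpsXn_diag //; apply/is_unitM/is_unitX.
    rewrite coef_fpsXn_gt ?mulr0 //= /bump /= add1n ltn_subrL.
    exact: leq_trans (ltn_ord i).
  exists x; apply: fpsP => n; rewrite -xP coef_fpsM.
  under eq_bigr => i _.
    rewrite (@coef_fps_comp _ _ _ _ n) ?leq_subr // mulr_sumr.
    over.
  rewrite exchange_big; apply: eq_bigr => k _.
  rewrite coef_fpsM mulr_sumr; apply: eq_bigr => i _.
  by rewrite mulrCA.
have [u uP] : exists u : fps D, fps_comp u f = fpsX D.
  have [|u uP] := @lower_triangular_solve D (fun n k => (f ^+ k) n) (fpsX D).
    by move=> n; rewrite coef_fpsXn_diag //; apply: is_unitX.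
  by exists u; apply: fpsP => n; rewrite -uP.
have x0 : is_unit (x 0%N).
  apply: (@is_unitMr (g 0%N)); rewrite -(coef0_fps_comp x f) -coef0_fpsM xP.
  exact: is_unit1.
have u0 : u 0%N = 0 by rewrite -(coef0_fps_comp u f) uP.
have u1 : is_unit (u 1%N).
  apply: (@is_unitMr (f 1%N)); rewrite mulrC -coef1_fps_comp // uP.
  exact: is_unit1.
by exists (Riordan x0 u0 u1); apply: riordanP.
Qed.

Definition riordan_inv r : riordan D := sval (cid (riordan_right_inverse r)).

Fact riordan_mulrV : right_inverse riordan_one riordan_inv riordan_mul.
Proof. by move=> r; rewrite /riordan_inv; case: cid. Qed.

Fact riordan_mulVr : left_inverse riordan_one riordan_inv riordan_mul.
Proof.
move=> r; rewrite -[LHS]riordan_mulr1 -[in LHS](riordan_mulrV (riordan_inv r)).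
rewrite -riordan_mulA [riordan_mul r _]riordan_mulA riordan_mulrV.
by rewrite riordan_mul1r riordan_mulrV.
Qed.

HB.instance Definition _ := isGroup.Build (riordan D)
  riordan_mulA riordan_mul1r riordan_mulr1 riordan_mulVr riordan_mulrV.

End RiordanGroup.

(* Main.v *)
Require Import Defs.
From mathcomp Require Import all_boot all_order all_algebra all_fingroup.

(** The diagonal of the Riordan array of [r] is multiplicative in [r] with
    values in a commutative ring, so every commutator of the Riordan group has
    diagonal 1.  Arrays with diagonal 1 are filtered by the number of
    subdiagonals on which they agree with the identity, and this filtration is
    central: the commutator of an array agreeing with the identity on the
    diagonal and the first k subdiagonals with an array of diagonal 1 agrees
    with the identity on one more subdiagonal ([near_id_commg]).  Only the
    identity lies in every step ([near_id_eq1]), so the arrays with diagonal 1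
    form a residually nilpotent group.

    In a symmetric group on at least four points, every 3-cycle is a
    commutator, and every double transposition is the commutator of another
    double transposition with a 3-cycle.  Hence, for any homomorphism to the
    Riordan group, 3-cycles have images with diagonal 1, and by induction on k
    the images of all double transpositions agree with the identity on their
    first k subdiagonals, for every k ([double_tperm_near_id]).  Double
    transpositions therefore lie in the kernel. *)

Import GRing.Theory.
Local Open Scope ring_scope.

Section RiordanArray.
Variable D : comPzRingType.
Implicit Types r s a b c u : riordan D.

(** The Riordan array of [r = (g, f)]: the coefficient of t^n in g f^m. *)
Definition riordan_array r n m : D := (riordan_g r * riordan_f r ^+ m) n.

Lemma riordan_array_gt r n m : (n < m)%N -> riordan_array r n m = 0.
Proof.
move=> lt_nm; rewrite /riordan_array coef_fpsM big1 // => i _.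
rewrite coef_fpsXn_gt ?mulr0 ?riordan_f0 //.
by rewrite (leq_ltn_trans (leq_subr _ _)).
Qed.

Lemma riordan_array_diag r n :
  riordan_array r n n = riordan_g r 0%N * riordan_f r 1%N ^+ n.
Proof.
have f0 := riordan_f0 r.
rewrite /riordan_array coef_fpsM big_ord_recl /= subn0 coef_fpsXn_diag //.
rewrite big1 ?addr0 // => i _; rewrite coef_fpsXn_gt ?mulr0 //.
by rewrite /= /bump /= add1n ltn_subrL (leq_trans _ (ltn_ord i)).
Qed.

Lemma riordan_array_diag_unit r n : is_unit (riordan_array r n n).
Proof.
rewrite riordan_array_diag.
by apply: is_unitM; [apply: riordan_g0 | apply/is_unitX/riordan_f1].
Qed.

(** The product of the Riordan group is the product of arrays; the sum stops
    at [n] because arrays are lower triangular. *)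
Lemma riordan_arrayM r s n m :
  riordan_array (r * s)%g n m
    = \sum_(j < n.+1) riordan_array r n j * riordan_array s j m.
Proof.
have f0 := riordan_f0 r.
have -> : riordan_array (r * s)%g n m
    = (riordan_g r * fps_comp (riordan_g s * riordan_f s ^+ m) (riordan_f r)) n.
  by rewrite fps_compM // fps_compXn // mulrA.
rewrite coef_fpsM.
under eq_bigr => i _.
  rewrite (@coef_fps_comp _ _ _ _ n) ?leq_subr // mulr_sumr.
  over.
rewrite exchange_big; apply: eq_bigr => j _.
rewrite /riordan_array [in RHS](coef_fpsM (riordan_g r)) mulr_suml.
by apply: eq_bigr => i _; rewrite [RHS]mulrAC mulrA.
Qed.

Lemma riordan_arrayM_diag r s n :
  riordan_array (r * s)%g n n = riordan_array r n n * riordan_array s n n.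
Proof.
rewrite riordan_arrayM big_ord_recr /= big1 ?add0r // => j _.
by rewrite [riordan_array s _ _]riordan_array_gt ?mulr0.
Qed.

(** The Riordan array of [r] agrees with the identity matrix on the diagonal
    and the first [k] subdiagonals (and above the diagonal, where both vanish).
    Thus [near_id 0 r] says that the diagonal entries are all 1. *)
Definition near_id k r : Prop :=
  forall n m, (n <= m + k)%N -> riordan_array r n m = (n == m)%:R.

(** Columns 0 and 1 of the array, g and g f, determine the pair (g, f). *)
Lemma near_id_eq1 r : (forall k, near_id k r) -> r = 1%g.
Proof.
move=> r1; have E n m : riordan_array r n m = (n == m)%:R.
  by apply: (r1 n); apply: leq_addl.
have g1 : riordan_g r = 1.
  by apply: fpsP => n; rewrite coef_fps1 -(E n 0%N) /riordan_array expr0 mulr1.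
apply: riordanP => //=; apply: fpsP => n.
by have := E n 1%N; rewrite /riordan_array expr1 g1 mul1r.
Qed.

(** Cancellation modulo the entries below the [k]-th subdiagonal.  It yields
    information on a commutator [c] of [a] and [b] from the relation
    [b * a * c = a * b], without computing inverses. *)
Lemma near_id_cancel k u c :
    (forall n m, (n <= m + k)%N ->
       riordan_array (u * c)%g n m = riordan_array u n m) ->
  near_id k c.
Proof.
move=> uc n m; elim/ltn_ind: n => n IHn le_n.
have [lt_nm|le_mn] := ltnP n m; first by rewrite riordan_array_gt // ltn_eqF.
(* In entry (n, m) of u c, every term u n j * c j m with j < n is known by
   induction; what remains determines c n m, since u n n is a unit. *)
have [y uy] := riordan_array_diag_unit u n.
have := uc n m le_n; rewrite riordan_arrayM big_ord_recr /=.
under eq_bigr => j _.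
  rewrite IHn //; last by rewrite (leq_trans _ le_n) // ltnW.
  over.
have [<-|ne_nm] := eqVneq n m => /=.
  rewrite big1 ?add0r => [E|j _]; last by rewrite ltn_eqF ?mulr0.
  by rewrite -[LHS]mul1r -uy mulrAC E uy.
have lt_mn : (m < n)%N by rewrite ltn_neqAle eq_sym ne_nm.
rewrite (bigD1 (Ordinal lt_mn)) //= eqxx mulr1.
rewrite big1 ?addr0 => [E|j]; last first.
  by rewrite -val_eqE /= => /negPf->; rewrite mulr0.
have {}E : riordan_array u n n * riordan_array c n m = 0.
  by apply: (addrI (riordan_array u n m)); rewrite E addr0.
by rewrite -[LHS]mul1r -uy mulrAC E mul0r.
Qed.

Lemma near_id0_commg r s : near_id 0 [~ r, s]%g.
Proof.
apply: (@near_id_cancel _ (s * r)%g) => n m; rewrite addn0 => le_nm.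
have -> : (s * r * [~ r, s] = r * s)%g by rewrite -commgC.
have [lt_nm|] := ltnP n m; first by rewrite !riordan_array_gt.
move=> le_mn; have /eqP-> : n == m by rewrite eqn_leq le_nm.
by rewrite !riordan_arrayM_diag mulrC.
Qed.

(** If all the terms of entry (n, m) of the matrix product (r - 1)(s - 1)
    vanish, then r s has there the entry of r + s - 1, an expression that is
    symmetric in r and s. *)
Lemma riordan_arrayM_add r s n m :
    (forall j, (riordan_array r n j - (n == j)%:R)
               * (riordan_array s j m - (j == m)%:R) = 0) ->
  riordan_array (r * s)%g n m
    = riordan_array r n m + riordan_array s n m - (n == m)%:R.
Proof.
move=> rs0; rewrite riordan_arrayM.
(* r n j * s j m = r n j * 1 j m + 1 n j * (s - 1) j m for each j. *)
transitivity (\sum_(j < n.+1) (riordan_array r n j * (j == m :> nat)%:R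
    + (n == j)%:R * (riordan_array s j m - (j == m :> nat)%:R))).
  apply: eq_bigr => j _; apply/eqP; rewrite -subr_eq0 -(rs0 j) mulrBl.
  by rewrite [X in _ == X - _]mulrBr opprD addrA.
rewrite big_split /= -addrA; congr (_ + _); last first.
  rewrite big_ord_recr /= eqxx mul1r big1 ?add0r // => j _.
  by rewrite gtn_eqF ?mul0r.
have [lt_nm|le_mn] := ltnP n m.
  rewrite riordan_array_gt // big1 // => j _.
  by rewrite ltn_eqF ?mulr0 // (leq_trans (ltn_ord j)).
rewrite (bigD1 (Ordinal (le_mn : (m < n.+1)%N))) //= eqxx mulr1.
by rewrite big1 ?addr0 // => j; rewrite -val_eqE /= => /negPf->; rewrite mulr0.
Qed.

(** The filtration is central.  For the arrays of [a] and [b], the products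
    (a - 1)(b - 1) and (b - 1)(a - 1) vanish down to the [k.+1]-st subdiagonal,
    so the arrays of [a * b] and [b * a] agree down to it. *)
Lemma near_id_commg k a b :
  near_id 0 a -> near_id k b -> near_id k.+1 [~ b, a]%g.
Proof.
move=> a1 b1; apply: (@near_id_cancel _ (a * b)%g) => n m le_n.
have -> : (a * b * [~ b, a] = b * a)%g by rewrite -commgC.
rewrite !riordan_arrayM_add ?[riordan_array b n m + _]addrC // => j.
  have [le_nj|lt_jn] := leqP n j; first by rewrite a1 ?addn0 // subrr mul0r.
  by rewrite b1 ?subrr ?mulr0 // -ltnS -addnS (leq_trans lt_jn).
have [le_jm|lt_mj] := leqP j m.
  by rewrite [riordan_array a _ _]a1 ?addn0 // subrr mulr0.
by rewrite b1 ?subrr ?mul0r // (leq_trans le_n) // addnS -addSn leq_add2r.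
Qed.

End RiordanArray.

Section Permutations.
Local Open Scope group_scope.
Variable T : finType.
Implicit Types x y z w : T.

(** Every 3-cycle is a commutator of transpositions. *)
Lemma tpermM_commg x y z :
  uniq [:: x; y; z] -> tperm x y * tperm x z = [~ tperm x y, tperm y z].
Proof.
rewrite /= !inE negb_or andbT => /andP[/andP[xy xz] yz].
rewrite commgEl tpermV tpermJ tpermL tpermD //; by rewrite eq_sym.
Qed.

(** Conjugation by a 3-cycle on [x, y, z] permutes the three double transpositions on
    [x, y, z, w] cyclically, and the product of two of them is the third. *)
Lemma double_tperm_commg x y z w : uniq [:: x; y; z; w] ->
  tperm x y * tperm z w
    = [~ tperm x z * tperm y w, tperm x z * tperm x y].
Proof.
move=> Uxyzw; have Uperm : uniq (rev [:: x; y; z; w]) by rewrite rev_uniq.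
move: Uxyzw Uperm; rewrite /rev /= !inE !negb_or !andbT -!andbA.
case/and5P=> xy xz xw yz /andP[yw zw] /and5P[wz wy wx zy /andP[zx yx]].
pose neqs := (negPf xy, negPf xz, negPf xw, negPf yz, negPf yw, negPf zw,
              negPf yx, negPf zx, negPf wx, negPf zy, negPf wy, negPf wz).
pose a := tperm x z * tperm x y.
rewrite commgEl invMg !tpermV conjMg !tpermJ -/a.
have -> : a x = z by rewrite permM !permE /= !(eqxx, neqs).
have -> : a y = x by rewrite permM !permE /= !(eqxx, neqs).
have -> : a z = y by rewrite permM !permE /= !(eqxx, neqs).
have -> : a w = w by rewrite permM !permE /= !(eqxx, neqs).
(* Pointwise comparison, at x, y, z, w and at any other point. *)
apply/permP=> i; rewrite !permM !permE /=.
have [i_x|ix] := eqVneq i x; first by rewrite ?i_x !(eqxx, neqs).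
have [i_y|iy] := eqVneq i y; first by rewrite ?i_y !(eqxx, neqs).
have [i_z|iz] := eqVneq i z; first by rewrite ?i_z !(eqxx, neqs).
have [i_w|iw] := eqVneq i w; first by rewrite ?i_w !(eqxx, neqs).
by rewrite !(negPf ix, negPf iy, negPf iz, negPf iw).
Qed.

End Permutations.

Lemma multiplicative_commg
    (G H : groupType) (f : {multiplicative G -> H}) a b :
  f [~ a, b]%g = [~ f a, f b]%g.
Proof. by apply: (mulgI (f b * f a)%g); rewrite -commgC -!gmulfM -commgC. Qed.

Lemma double_tperm_near_id (D : comPzRingType) (T : finType)
    (mu : {multiplicative {perm T} -> riordan D}) k (x y z w : T) :
  uniq [:: x; y; z; w] -> near_id D k (mu (tperm x y * tperm z w)%g).
Proof.
elim: k => [|k IHk] in x y z w * => Uxyzw;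
    rewrite double_tperm_commg // multiplicative_commg.
  exact: near_id0_commg.
have Uxzyw : uniq [:: x; z; y; w].
  rewrite -(perm_uniq (s1 := [:: x; y; z; w])) // perm_cons.
  exact/permEl/(perm_catCA [:: y] [:: z]).
apply: near_id_commg; last exact: IHk.
(* A 3-cycle is a commutator, so its image has diagonal 1. *)
rewrite tpermM_commg ?multiplicative_commg; first exact: near_id0_commg.
by move: Uxzyw; rewrite (cat_uniq [:: x; z; y] [:: w]) => /andP[].
Qed.

Theorem theorem4 (D : comPzRingType) (n : nat) (hn : (4 <= n)%N) :
  ~ exists mu : {multiplicative 'S_n -> riordan D}, injective mu.
Proof.
case=> mu mu_inj; case: n hn mu mu_inj => [|[|[|[|n]]]] // _ mu mu_inj.
pose i k (lt_k4 : (k < 4)%N) : 'I_n.+4 :=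
  Ordinal (leq_trans lt_k4 (leq_addr n 4)).
pose v : 'S_n.+4 :=
  (tperm (i 0%N isT) (i 1%N isT) * tperm (i 2%N isT) (i 3%N isT))%g.
have mu_v : mu v = 1%g.
  by apply: near_id_eq1 => k; apply: double_tperm_near_id.
(* [mu (v * v) = mu v], hence [v * v = v] by injectivity. *)
have v1 : v = 1%g.
  by apply: (mulgI v); apply: mu_inj; rewrite mulg1 gmulfM mu_v mulg1.
have := congr1 (fun s : 'S_n.+4 => val (s (i 0%N isT))) v1.
by rewrite permM tpermL tpermD // perm1.
Qed.
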